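(* Let $R$ be a commutative ring with non-zero identity, $K$ a proper ideal of $R$ and $J$ a maximal ideal of $R$. Let $\bar{K}=\{(a,a+j): a\in R,\ j\in J,\ a+j\in K\}$. (1) If $\bar{K}$ is a $J$-ideal of $R\Join J$, then $K$ is a $J$-ideal of $R$. Moreover, the converse is true if $J\subseteq J(R)$. (2) If $\bar{K}$ is a weakly $J$-ideal of $R\Join J$, then $K$ is a weakly $J$-ideal of $R$ and, whenever $a,b\in R$ and $j,k\in J$ satisfy $a+j\notin J(R)$, $b+k\notin K$ and $ab+ak+bj+jk=0$, then $ab=0$. Moreover, the converse is true if $J\subseteq J(R)$.
   Context: $J(A)$ denotes the Jacobson radical of a ring $A$. The terms ''$J$-ideal'' and ''weakly $J$-ideal'' refer to the Jacobson radical, not to the ideal named $J$: a proper ideal $I$ of a ring $A$ is a $J$-ideal if whenever $a,b\in A$ with $ab\in I$ and $a\notin J(A)$, then $b\in I$; it is a weakly $J$-ideal if whenever $a,b\in A$ with $0\neq ab\in I$ and $a\notin J(A)$, then $b\in I$. The amalgamated duplication of $R$ along $J$ is the subring $R\Join J=\{(r,r+j): r\in R, j\in J\}$ of $R\times R$; $\bar{K}$ is an ideal of it. *)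

(* Defs.v *)
From HB Require Import structures.
From mathcomp Require Import all_boot all_algebra ring_quotient boolp.

Set Implicit Arguments.
Unset Strict Implicit.
Unset Printing Implicit Defensive.

Import GRing.Theory.
Local Open Scope ring_scope.

(* A proper ideal is a term of the library type [idealr A], that is, a boolean
   predicate on A containing 0 but not 1 and closed under subtraction and under
   multiplication by elements of A. By the classical axioms every subset of A is
   given by a boolean predicate, through [`[< _ >]], so decidability is no
   restriction. *)

(* Properness of M is part of its type. *)
Definition maximal_ideal (A : comNzRingType) (M : idealr A) : Prop :=
  forall I : idealr A, {subset M <= I} ->
    I =i M.

Definition jacobson_radical (A : comNzRingType) : {pred A} :=
  fun x => `[< forall M : idealr A, maximal_ideal M -> x \in M >].

Arguments jacobson_radical A : clear implicits.

Definition J_ideal (A : comNzRingType) (I : idealr A) : Prop :=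
  forall a b : A, a * b \in I ->
    a \notin jacobson_radical A -> b \in I.

Definition weakly_J_ideal (A : comNzRingType) (I : idealr A) : Prop :=
  forall a b : A, a * b != 0 -> a * b \in I ->
    a \notin jacobson_radical A -> b \in I.

Section Amalgamation.
Variables (R : comNzRingType) (J : idealr R).

Definition amalg_pred : {pred R * R} :=
  fun x => `[< exists r j : R, j \in J /\ x = (r, r + j) >].

Lemma amalg_predE (x : R * R) :
  (x \in amalg_pred) = (x.2 - x.1 \in J).
Proof.
apply/asboolP/idP => [[r [j [Jj ->]]] | Jx]; first by rewrite /= addrC addKr.
by exists x.1, (x.2 - x.1); rewrite [x.1 + _]addrC subrK -surjective_pairing.
Qed.

Fact amalg_subring_closed : subring_closed amalg_pred.
Proof.
split=> [|x y|x y]; rewrite !amalg_predE /=.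
- by rewrite subrr rpred0.
- move=> Jx Jy; have -> : x.2 - y.2 - (x.1 - y.1) = x.2 - x.1 - (y.2 - y.1).
    by rewrite !opprB addrACA [RHS]addrACA [- y.2 - _]addrC.
  by rewrite rpredB.
move=> Jx Jy.
have -> : x.2 * y.2 - x.1 * y.1 = y.2 * (x.2 - x.1) + x.1 * (y.2 - y.1).
  by rewrite !mulrBr addrA [y.2 * x.2]mulrC [y.2 * x.1]mulrC subrK.
by rewrite rpredD // idealMr.
Qed.

HB.instance Definition _ :=
  GRing.isSubringClosed.Build (R * R)%type amalg_pred amalg_subring_closed.

Record amalg := Amalg { amalg_val : R * R; _ : amalg_val \in amalg_pred }.

HB.instance Definition _ := [isSub for amalg_val].
HB.instance Definition _ := [Choice of amalg by <:].
HB.instance Definition _ := [SubChoice_isSubComNzRing of amalg by <:].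

Variable K : idealr R.

Definition amalg_ideal : {pred amalg} :=
  fun x => `[< exists a j : R,
    [/\ j \in J, a + j \in K & val x = (a, a + j)] >].

Lemma amalg_idealE (x : amalg) :
  (x \in amalg_ideal) = ((val x).2 \in K).
Proof.
apply/asboolP/idP => [[a [j [_ Kaj ->]]] // | Kx].
have := valP x; rewrite amalg_predE => Jx.
exists (val x).1, ((val x).2 - (val x).1).
by rewrite [(val x).1 + _]addrC subrK -surjective_pairing.
Qed.

Fact amalg_ideal_closed : idealr_closed amalg_ideal.
Proof.
split=> [||a u v]; rewrite !amalg_idealE /=.
- exact: idealr0.
- by rewrite idealr1.
by move=> Ku Kv; rewrite rpredD // idealMr.
Qed.

HB.instance Definition _ := isIdealr.Build amalg amalg_ideal amalg_ideal_closed.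

End Amalgamation.

Arguments amalg_ideal {R} J K _.

(* Main.v *)
(* Every maximal ideal N of R ⋈ J contracts along the diagonal R -> R ⋈ J to a
   maximal ideal of R: if (1 - rs, 1 - rs') lies in N, then so does its product
   with (1 - rs', 1 - rs), which is diagonal and congruent to 1 modulo r. Since
   x^2 = (x_1 + x_2) x - x_1 x_2 for the diagonal coefficients x_1 + x_2 and
   x_1 x_2, an element x whose two components are in J(R) is in N. Conversely
   both projections are surjective, hence map J(R ⋈ J) to J(R). The corollary
   then follows by comparing second components. *)

From HB Require Import structures.
Require Import Defs.
From mathcomp Require Import all_boot all_algebra ring_quotient boolp.
From mathcomp Require Import ring.

Set Implicit Arguments.
Unset Strict Implicit.
Unset Printing Implicit Defensive.

Import GRing.Theory.
Local Open Scope ring_scope.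

Section Preimage.
Variables (A B : comNzRingType) (f : {rmorphism A -> B}) (I : idealr B).

Definition preim_ideal : {pred A} := fun x => f x \in I.

Lemma preim_idealE x : (x \in preim_ideal) = (f x \in I).
Proof. by []. Qed.

Fact preim_ideal_closed : idealr_closed preim_ideal.
Proof.
split=> [||a u v]; rewrite !preim_idealE.
- by rewrite rmorph0 idealr0.
- by rewrite rmorph1 idealr1.
by move=> Iu Iv; rewrite rmorphD rmorphM rpredD // idealMr.
Qed.

HB.instance Definition _ := isIdealr.Build A preim_ideal preim_ideal_closed.

End Preimage.

(** The ideal I + xA, kept as a bare predicate because it inhabits [idealr] only when it is proper,
    that is, when no 1 - xy lies in I. *)
Definition add_principal (A : comNzRingType) (I : idealr A) (x : A) :
    {pred A} :=
  fun z => `[< exists y, z - x * y \in I >].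

Lemma add_principal_closed (A : comNzRingType) (I : idealr A) (x : A) :
  (forall y, 1 - x * y \notin I) -> idealr_closed (add_principal I x).
Proof.
move=> x_ninv; split=> [||a u v].
- by apply/asboolP; exists 0; rewrite mulr0 subrr idealr0.
- by apply/asboolP => -[y]; apply/negP.
move=> /asboolP[y Iy] /asboolP[z Iz]; apply/asboolP; exists (a * y + z).
have -> : a * u + v - x * (a * y + z) = a * (u - x * y) + (v - x * z) by ring.
by rewrite rpredD // idealMr.
Qed.

(** The quotient by M is a field. If x had no inverse modulo M, then M + xA would be a proper ideal
    above M, hence equal to M, yet it contains x. *)
Lemma maximal_idealP (A : comNzRingType) (M : idealr A) :
  maximal_ideal M <-> forall x, x \notin M -> exists y, 1 - x * y \in M.
Proof.
split=> [maxM x Mx | invM I sMI x].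
  apply: contrapT => ninv.
  have nu y : 1 - x * y \notin M by apply/negP => My; apply: ninv; exists y.
  pose I : idealr A :=
    HB.pack (add_principal M x)
      (isIdealr.Build A (add_principal M x) (add_principal_closed nu)).
  have sMI : {subset M <= I}.
    by move=> z Mz; apply/asboolP; exists 0; rewrite mulr0 subr0.
  move/negP: Mx; apply; rewrite -(maxM I sMI).
  by apply/asboolP; exists 1; rewrite mulr1 subrr idealr0.
apply/idP/idP; last exact: sMI.
(* An x in I outside M would put 1 = (1 - xy) + xy in I. *)
apply: contraLR => /invM[y /sMI Iy]; apply/negP => Ix.
have := idealr1 I; rewrite -(subrK (x * y) 1) rpredD //.
by rewrite mulrC idealMr.
Qed.

(** If y inverts x modulo M, then x is congruent to y x^2, which lies in M. *)
Lemma maximal_ideal_sqr (A : comNzRingType) (M : idealr A) (x : A) :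
  maximal_ideal M -> x * x \in M -> x \in M.
Proof.
move=> /maximal_idealP invM Mxx; apply: contraT => Mx.
have [y My] := invM x Mx; rewrite -(negPf Mx).
have -> : x = x * (1 - x * y) + y * (x * x) by ring.
by rewrite rpredD // idealMr.
Qed.

(** Surjectivity lifts an inverse of f x modulo M to an inverse of x modulo the preimage. *)
Lemma maximal_preim_ideal (A B : comNzRingType) (f : {rmorphism A -> B})
    (M : idealr B) :
  (forall b, exists a, f a = b) ->
  maximal_ideal M -> maximal_ideal (preim_ideal f M).
Proof.
move=> f_surj /maximal_idealP invM; apply/maximal_idealP => x /invM[b Mb].
have [a fa] := f_surj b; exists a.
by rewrite preim_idealE rmorphB rmorph1 rmorphM fa.
Qed.

Lemma jacobson_radical_surj (A B : comNzRingType) (f : {rmorphism A -> B})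
    (x : A) :
  (forall b, exists a, f a = b) ->
  x \in jacobson_radical A -> f x \in jacobson_radical B.
Proof.
move=> f_surj /asboolP Jx; apply/asboolP => M maxM.
exact: Jx _ (maximal_preim_ideal f_surj maxM).
Qed.

Section Amalgamation.
Variables (R : comNzRingType) (J : idealr R).
Implicit Types (r s : R) (x : amalg J).

Fact amalg_pair_subproof r j : j \in J -> (r, r + j) \in amalg_pred J.
Proof. by move=> Jj; rewrite amalg_predE /= addrC addKr. Qed.

Definition amalg_pair r j (Jj : j \in J) : amalg J :=
  Amalg (amalg_pair_subproof r Jj).

Fact amalg_diag_subproof r : (r, r) \in amalg_pred J.
Proof. by rewrite amalg_predE /= subrr idealr0. Qed.

Definition amalg_diag r : amalg J := Amalg (amalg_diag_subproof r).

Fact amalg_diag_is_zmod_morphism : zmod_morphism amalg_diag.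
Proof. by move=> r s; apply: val_inj. Qed.

Fact amalg_diag_is_monoid_morphism : monoid_morphism amalg_diag.
Proof. by split=> [|r s]; apply: val_inj. Qed.

HB.instance Definition _ :=
  GRing.isZmodMorphism.Build R (amalg J) amalg_diag amalg_diag_is_zmod_morphism.
HB.instance Definition _ :=
  GRing.isMonoidMorphism.Build R (amalg J) amalg_diag
    amalg_diag_is_monoid_morphism.

Fact amalg_swap_subproof x : ((val x).2, (val x).1) \in amalg_pred J.
Proof. by have := valP x; rewrite !amalg_predE /= -opprB rpredN. Qed.

Definition amalg_swap x : amalg J := Amalg (amalg_swap_subproof x).

Lemma maximal_diag_preim (N : idealr (amalg J)) :
  maximal_ideal N -> maximal_ideal (preim_ideal amalg_diag N).
Proof.
move=> /maximal_idealP invN; apply/maximal_idealP => r /invN[y Ny].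
(* With y = (s, s'), the witness comes from (1 - rs)(1 - rs') = 1 - r(s + s' - rss'). *)
exists ((val y).1 + (val y).2 - r * (val y).1 * (val y).2); rewrite preim_idealE /=.
suff -> : amalg_diag (1 - r * ((val y).1 + (val y).2
            - r * (val y).1 * (val y).2))
          = amalg_swap (1 - amalg_diag r * y) * (1 - amalg_diag r * y).
  by rewrite idealMr.
by apply: val_inj; congr (_, _) => /=; ring.
Qed.

Lemma amalg_jacobson_radicalE x :
  (x \in jacobson_radical (amalg J)) =
  ((val x).1 \in jacobson_radical R) && ((val x).2 \in jacobson_radical R).
Proof.
apply/idP/andP => [Jx | [/asboolP Jx1 /asboolP Jx2]].
  split.
    apply: (jacobson_radical_surj (f := fst \o val)) Jx => r.
    by exists (amalg_diag r).
  apply: (jacobson_radical_surj (f := snd \o val)) Jx => r.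
  by exists (amalg_diag r).
apply/asboolP => N maxN; apply: maximal_ideal_sqr => //.
have maxc := maximal_diag_preim maxN.
have Nx1 : amalg_diag (val x).1 \in N := Jx1 _ maxc.
have Nx2 : amalg_diag (val x).2 \in N := Jx2 _ maxc.
have -> : x * x = x * (amalg_diag (val x).1 + amalg_diag (val x).2)
                  - amalg_diag (val x).1 * amalg_diag (val x).2.
  by apply: val_inj; congr (_, _) => /=; ring.
by rewrite rpredB ?idealMr ?rpredD.
Qed.

(** The components of x differ by an element of J, hence of J(R), so the first lies in J(R) as soon
    as the second does. *)
Lemma amalg_jacobson_radical_snd x :
  {subset J <= jacobson_radical R} ->
  (x \in jacobson_radical (amalg J)) = ((val x).2 \in jacobson_radical R).
Proof.
move=> sJ; rewrite amalg_jacobson_radicalE andb_idl // => /asboolP Jx2.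
have /sJ/asboolP Jd : (val x).2 - (val x).1 \in J.
  by have := valP x; rewrite amalg_predE.
apply/asboolP => M maxM.
by rewrite -(subKr (val x).2 (val x).1) rpredB ?Jx2 ?Jd.
Qed.

End Amalgamation.

Theorem corollary8 (R : comNzRingType) (K J : idealr R)
    (maxJ : maximal_ideal J) :
  ((J_ideal (amalg_ideal J K) -> J_ideal K)
   /\ ({subset J <= jacobson_radical R} ->
       J_ideal K -> J_ideal (amalg_ideal J K)))
  /\
  ((weakly_J_ideal (amalg_ideal J K) ->
      weakly_J_ideal K
      /\ (forall a b j k : R,
            j \in J -> k \in J ->
            a + j \notin jacobson_radical R -> b + k \notin K ->
            a * b + a * k + b * j + j * k = 0 -> a * b = 0))
   /\ ({subset J <= jacobson_radical R} ->
       weakly_J_ideal K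
       /\ (forall a b j k : R,
             j \in J -> k \in J ->
             a + j \notin jacobson_radical R -> b + k \notin K ->
             a * b + a * k + b * j + j * k = 0 -> a * b = 0) ->
       weakly_J_ideal (amalg_ideal J K))).
Proof.
split; [split | split].
- move=> KJ a b Kab Ja.
  have := KJ (amalg_diag J a) (amalg_diag J b).
  by rewrite !amalg_idealE amalg_jacobson_radicalE /= andbb; apply.
(* Every membership now depends on second components only. *)
- move=> sJ KJ x y; rewrite !amalg_idealE amalg_jacobson_radical_snd //.
  exact: KJ.
- move=> KJ; split=> [a b nz_ab Kab Ja | a b j k Jj Jk Ja Kb ab0].
    have := KJ (amalg_diag J a) (amalg_diag J b).
    rewrite !amalg_idealE amalg_jacobson_radicalE /= andbb; apply=> //.
    by apply: contra_neq nz_ab => /(congr1 (fst \o val)).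
  (* If ab is nonzero, then (a, a + j)(b, b + k) = (ab, 0) is a nonzero element of
     [amalg_ideal J K], which forces b + k into K; a + j outside J(R) already keeps the first factor
     out of the radical. *)
  apply: contrapT => /eqP nz_ab; case/negP: Kb.
  have := KJ (amalg_pair a Jj) (amalg_pair b Jk).
  rewrite !amalg_idealE amalg_jacobson_radicalE /= negb_and Ja orbT; apply=> //.
    by apply: contra_neq nz_ab => /(congr1 (fst \o val)).
  suff -> : (a + j) * (b + k) = 0 by rewrite idealr0.
  by rewrite -ab0; ring.
move=> sJ [KJ zero_prod] x y nz_xy.
rewrite !amalg_idealE amalg_jacobson_radical_snd // => Kxy Jx.
(* If the second component of y is outside K, both components of xy vanish: the second because K is
   weakly J, then the first by [zero_prod]. *)
apply: contraT => Ky; case/eqP: nz_xy.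
have xy2 : (val x).2 * (val y).2 = 0.
  by apply: contraNeq Ky => nz; apply: KJ nz Kxy Jx.
have xE (z : amalg J) : (val z).1 + ((val z).2 - (val z).1) = (val z).2.
  by rewrite addrC subrK.
have JB (z : amalg J) : (val z).2 - (val z).1 \in J.
  by have := valP z; rewrite amalg_predE.
have xy1 : (val x).1 * (val y).1 = 0.
  (* Here a, b are the first components and j, k the differences, so a + j and b + k are the second
     components. *)
  apply: (zero_prod _ _ _ _ (JB x) (JB y)); rewrite ?xE //.
  by rewrite -xy2; ring.
by apply: val_inj; congr (_, _).
Qed.
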